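(* Let $d_1,d_2$ be positive integers, let $a_0,\dots,a_{d_1},b_0,\dots,b_{d_2}$ be algebraically independent variables over $\mathbb{Q}$, let $K:=\mathbb{Q}(a_0,\dots,a_{d_1},b_0,\dots,b_{d_2})$, and let $f:=a_0+a_1x+\cdots+a_{d_1}x^{d_1}$ and $g:=b_0+b_1x+\cdots+b_{d_2}x^{d_2}$ in $K[x]$. Let $\{\xi_1,\dots,\xi_{d_2}\}$ be the set of roots of $g$ in an algebraic closure $\overline K$ of $K$, and let $\mathcal{V}_{d_2}:=\det(\xi_j^{i-1})_{1\le i,j\le d_2}$. Let $t$ be any integer with $0\le t\le d_1+d_2-1$, put $t^*:=\max\{d_2-1,t\}$ and $$k:=t+1-\max\{0,t-d_1+1\}-\max\{0,t-d_2+1\}.$$ Let $\mathcal{S}=\{x^{\gamma_1},\dots,x^{\gamma_k}\}$, $0\le\gamma_1<\dots<\gamma_k\le t$, be any set of $k$ monomials of degree at most $t$. Then the order $t$ subresultant $\Delta_{\mathcal{S}}$ of $f,g$ with respect to $\mathcal{S}$ satisfies $$\Delta_{\mathcal{S}}=\mathrm{sg}(\mathcal{S})\; b_{d_2}^{\,t^*-d_2+1}\;\frac{|\mathcal{O}_{\mathcal{S}}|}{\mathcal{V}_{d_2}},$$ where $|\cdot|$ denotes the determinant and $\mathcal{O}_{\mathcal{S}}\in\overline K^{d_2\times d_2}$ is the matrix $$\mathcal{O}_{\mathcal{S}}=\left[\begin{array}{ccc} \xi_1^{\gamma_1}&\cdots&\xi_{d_2}^{\gamma_1}\\ \vdots&&\vdots\\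 \xi_1^{\gamma_k}&\cdots&\xi_{d_2}^{\gamma_k}\\ \hline \xi_1^{t+1}&\cdots&\xi_{d_2}^{t+1}\\ \vdots&&\vdots\\ \xi_1^{t^*}&\cdots&\xi_{d_2}^{t^*}\\ \hline \xi_1^0f(\xi_1)&\cdots&\xi_{d_2}^0f(\xi_{d_2})\\ \vdots&&\vdots\\ \xi_1^{t-d_1}f(\xi_1)&\cdots&\xi_{d_2}^{t-d_1}f(\xi_{d_2}) \end{array}\right]$$ (the middle block is empty if $t^*=t$, and the last block is empty if $t<d_1$).
   Context: For $j\in\mathbb{Z}$, $K[x]_j:=\{0\}\cup\{h\in K[x]:\deg h\le j\}$, which is $\{0\}$ if $j<0$. Matrices $M_f$, $M_g$. All monomial bases are ordered increasingly $1,x,x^2,\dots$. $M_f$ is the $\max\{0,t-d_1+1\}\times(t^*+1)$ matrix whose rows are the coefficient vectors, in the basis $1,x,\dots,x^{t^*}$ of $K[x]_{t^*}$, of $f,xf,\dots,x^{t-d_1}f$ (in this order). $M_g$ is the $\max\{0,t-d_2+1\}\times(t^*+1)$ matrix whose rows are the coefficient vectors of $g,xg,\dots,x^{t-d_2}g$ in the same basis. $M_f$ is empty if $t<d_1$ and $M_g$ is empty if $t<d_2$. Order $t$ subresultant. $\Delta_{\mathcal{S}}=\Delta_{\mathcal{S}}^{(t)}(f,g)$ is the determinant of the square matrix obtained by stacking the rows of $M_f$ first and then the rows of $M_g$, and deleting the $k+t^*-t$ columns indexed by the monomials in $\mathcal{S}\cup\{x^{t+1},\dots,x^{t^*}\}$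 (the remaining columns keep their order). The determinant of an empty matrix is $1$. Sign. $\mathrm{sg}(\mathcal{S}):=(-1)^\sigma$, where $\sigma$ is the number of transpositions needed to bring the sequence $(1,x,x^2,\dots,x^{t^*})$ to the sequence $(x^{\gamma_1},\dots,x^{\gamma_k},x^{t+1},\dots,x^{t^*},\text{ followed by the monomials of degree}\le t\text{ not in }\mathcal{S}\text{ in increasing order})$. *)

(* Defs.v *)
From HB Require Import structures.
From mathcomp Require Import all_boot all_order all_algebra perm.
From mathcomp Require Import mpoly zify.

Set Implicit Arguments.
Unset Strict Implicit.
Unset Printing Implicit Defensive.

Import GRing.Theory.
Local Open Scope ring_scope.

(* The indeterminates of index < d1.+1 are the a_i, the others are the b_j. *)
Definition coefField (d1 d2 : nat) : fieldType :=
  {fraction {mpoly rat[d1.+1 + d2.+1]}}.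

Definition acoef (d1 d2 : nat) (i : 'I_d1.+1) : coefField d1 d2 :=
  tofrac ('X_(lshift d2.+1 i) : {mpoly rat[d1.+1 + d2.+1]}).

Definition bcoef (d1 d2 : nat) (j : 'I_d2.+1) : coefField d1 d2 :=
  tofrac ('X_(rshift d1.+1 j) : {mpoly rat[d1.+1 + d2.+1]}).

Definition fgen (d1 d2 : nat) : {poly coefField d1 d2} :=
  \sum_(i < d1.+1) acoef d2 i *: 'X^i.

Definition ggen (d1 d2 : nat) : {poly coefField d1 d2} :=
  \sum_(j < d2.+1) bcoef d1 j *: 'X^j.

(* A field L with a morphism iota : F -> L is an algebraic closure of F. *)
Definition algebraic_closure (F : fieldType) (L : closedFieldType)
    (iota : {rmorphism F -> L}) : Prop :=
  forall z : L, algebraicOver iota z.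

Definition tstar (d2 t : nat) : nat := maxn d2.-1 t.

(* On nat, t.+1 - d is max(0, t - d + 1); when t < d1 + d2 neither of the two
   outer subtractions below truncates. *)
Definition kdim (d1 d2 t : nat) : nat := t.+1 - (t.+1 - d1) - (t.+1 - d2).

Lemma leq_tstar (d2 t : nat) : (t.+1 <= (tstar d2 t).+1)%N.
Proof. by rewrite /tstar; lia. Qed.

(* A monomial x^e is represented by its exponent e; a set of monomials of
   degree at most t is therefore a {set 'I_t.+1}.  The enumerations enum and
   enum_val of a set of ordinals are increasing. *)
Definition lowS (d2 t : nat) (S : {set 'I_t.+1}) : {set 'I_(tstar d2 t).+1} :=
  [set widen_ord (leq_tstar d2 t) e | e in S].

Definition highmon (d2 t : nat) : {set 'I_(tstar d2 t).+1} :=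
  [set j : 'I_(tstar d2 t).+1 | (t < j)%N].

Definition deleted (d2 t : nat) (S : {set 'I_t.+1}) : {set 'I_(tstar d2 t).+1} :=
  lowS d2 S :|: highmon d2 t.

Definition kept (d2 t : nat) (S : {set 'I_t.+1}) : {set 'I_(tstar d2 t).+1} :=
  ~: deleted d2 S.

Definition reordered (d2 t : nat) (S : {set 'I_t.+1}) : seq 'I_(tstar d2 t).+1 :=
  enum (lowS d2 S) ++ enum (highmon d2 t) ++ enum (kept d2 S).

Lemma disjoint_low_high (d2 t : nat) (S : {set 'I_t.+1}) :
  lowS d2 S :&: highmon d2 t = set0.
Proof.
apply/setP=> j; rewrite !inE; apply/negP=> /andP[/imsetP[e _ ->]] /=.
by rewrite ltnNge -ltnS ltn_ord.
Qed.

Lemma card_lowS (d2 t : nat) (S : {set 'I_t.+1}) : #|lowS d2 S| = #|S|.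
Proof. by apply: card_imset => e e' /(congr1 val) /= /val_inj. Qed.

Lemma card_highmon (d2 t : nat) : #|highmon d2 t| = (tstar d2 t - t)%N.
Proof.
have := cardsC (highmon d2 t); rewrite card_ord.
suff -> : #|~: highmon d2 t| = t.+1 by have := leq_tstar d2 t; lia.
rewrite -[RHS]card_ord -cardsT -(card_imset _ (f := widen_ord (leq_tstar d2 t))).
  apply: eq_card => j; rewrite !inE -leqNgt; apply/idP/imsetP => [le_jt|[e _ ->]].
    by exists (Ordinal (le_jt : (j < t.+1)%N)) => //; apply: val_inj.
  by rewrite -ltnS /=.
by move=> e e' /(congr1 val) /= /val_inj.
Qed.

Lemma perm_reordered (d2 t : nat) (S : {set 'I_t.+1}) :
  perm_eq (reordered d2 S) (enum 'I_(tstar d2 t).+1).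
Proof.
apply: uniq_perm; rewrite ?enum_uniq //.
  rewrite /reordered !cat_uniq !enum_uniq /= andbT.
  apply/andP; split; apply/hasPn => j.
    rewrite mem_cat !mem_enum => /orP[hj|].
      apply/negP=> lj; have /setP/(_ j) := disjoint_low_high d2 S.
      by rewrite in_setI lj hj inE.
    by rewrite /kept /deleted in_setC in_setU negb_or => /andP[].
  rewrite !mem_enum /kept /deleted in_setC in_setU negb_or.
  by case/andP.
move=> j; rewrite !mem_cat !mem_enum /kept /deleted in_setC in_setU orbA.
by rewrite orbN inE.
Qed.

Lemma reordered_inj (d2 t : nat) (S : {set 'I_t.+1}) :
  injective (fun i : 'I_(tstar d2 t).+1 => nth ord0 (reordered d2 S) i).
Proof.
have sz : size (reordered d2 S) = (tstar d2 t).+1.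
  by rewrite (perm_size (perm_reordered d2 S)) size_enum_ord.
have un : uniq (reordered d2 S) by rewrite (perm_uniq (perm_reordered d2 S)) enum_uniq.
move=> i j /eqP; rewrite nth_uniq ?sz //.
by move=> /eqP/val_inj.
Qed.

Definition reorder_perm (d2 t : nat) (S : {set 'I_t.+1}) : 'S_(tstar d2 t).+1 :=
  perm (@reordered_inj d2 t S).

(* The coercion to bool of a permutation is the parity of the number of
   transpositions in its decompositions. *)
Definition sg (d2 t : nat) (S : {set 'I_t.+1}) (R : nzRingType) : R :=
  (-1) ^+ reorder_perm d2 S.

Lemma card_kept (d1 d2 t : nat) (S : {set 'I_t.+1}) :
  (t < d1 + d2)%N -> #|S| = kdim d1 d2 t ->
  #|kept d2 S| = ((t.+1 - d1) + (t.+1 - d2))%N.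
Proof.
move=> ltt cardS; have := cardsC (deleted d2 S).
rewrite card_ord /deleted cardsU disjoint_low_high cards0.
rewrite card_lowS card_highmon cardS /kept /deleted /kdim.
have := leq_tstar d2 t; lia.
Qed.

Lemma height_Omx (d1 d2 t : nat) (S : {set 'I_t.+1}) :
  (0 < d2)%N -> (t < d1 + d2)%N -> #|S| = kdim d1 d2 t ->
  (#|S| + ((tstar d2 t - t) + (t.+1 - d1)))%N = d2.
Proof. by move=> d2_gt0 ltt ->; rewrite /kdim /tstar; lia. Qed.

(* M_f is shift_mx d1 d2 t f and M_g is shift_mx d2 d2 t g. *)
Definition shift_mx (R : nzRingType) (d d2 t : nat) (h : {poly R}) :
    'M[R]_(t.+1 - d, (tstar d2 t).+1) :=
  \matrix_(i, j) ('X^i * h)`_j.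

Definition subresultant (R : comNzRingType) (d1 d2 t : nat)
    (S : {set 'I_t.+1}) (ltt : (t < d1 + d2)%N)
    (cardS : #|S| = kdim d1 d2 t) (f g : {poly R}) : R :=
  \det (castmx (erefl _, card_kept ltt cardS)
    (colsub (fun j : 'I_#|kept d2 S| => enum_val j)
      (col_mx (shift_mx d1 d2 t f) (shift_mx d2 d2 t g)))).

Definition Omx (R : nzRingType) (d1 d2 t : nat) (S : {set 'I_t.+1})
    (d2_gt0 : (0 < d2)%N) (ltt : (t < d1 + d2)%N)
    (cardS : #|S| = kdim d1 d2 t) (f : {poly R}) (xi : 'I_d2 -> R) :
    'M[R]_d2 :=
  castmx (height_Omx d2_gt0 ltt cardS, erefl d2)
    (col_mx (\matrix_(i < #|S|, j < d2) xi j ^+ (enum_val i : 'I_t.+1))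
    (col_mx (\matrix_(i < tstar d2 t - t, j < d2) xi j ^+ (t.+1 + i))
            (\matrix_(i < t.+1 - d1, j < d2) (xi j ^+ i * f.[xi j])))).

(* Main.v *)
(** Border the subresultant matrix with the unit rows of the deleted monomials:
    the resulting square matrix [P], whose rows are the coefficient vectors of
    polynomials [p_i], has determinant [sg S * subresultant].  Multiplying [P]
    on the right by the matrix whose first [d2] columns are the vectors
    [(xi_j ^ i)_i] and whose remaining columns are unit vectors (of determinant
    the Vandermonde [V]) evaluates the [p_i] at the roots of [g].  The rows of
    multiples of [g] vanish there, so the product is block upper triangular with
    diagonal blocks [O_S] and a triangular matrix with the leading coefficient
    of [g] on its diagonal.
    Finally [V] is nonzero because the discriminant of the generic [g] does not
    vanish: it specializes to that of ['X^d2 - 1]. *)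

Require Import Defs.
From HB Require Import structures.
From mathcomp Require Import all_boot all_order all_algebra.
From mathcomp Require Import perm separable cyclotomic mpoly zify.

Set Implicit Arguments.
Unset Strict Implicit.
Unset Printing Implicit Defensive.

Import GRing.Theory.
Local Open Scope ring_scope.

(** * Block determinants, and coefficient matrices evaluated at roots *)

Section NatIndexedDeterminants.
Variable R : comNzRingType.

(** Indexing entries by natural numbers makes the blocks plain index shifts, with no casts along
    [m + n = N]. *)
Lemma det_lblock_nat m n N (mnN : (m + n)%N = N) (F : nat -> nat -> R) :
  (forall i j, (i < m <= j)%N -> (j < N)%N -> F i j = 0) ->
  \det (\matrix_(i < N, j < N) F i j) =
    \det (\matrix_(i < m, j < m) F i j) *
    \det (\matrix_(i < n, j < n) F (m + i)%N (m + j)%N).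
Proof.
case: N / mnN => F0; rewrite -[X in \det X = _]submxK.
rewrite [ursubmx _](_ : _ = 0); last first.
  by apply/matrixP=> i j; rewrite !mxE F0 //=;
    have := ltn_ord i; have := ltn_ord j; lia.
rewrite det_lblock.
by congr (_ * _); congr (\det _); apply/matrixP=> i j; rewrite !mxE.
Qed.

Lemma det_ublock_nat m n N (mnN : (m + n)%N = N) (F : nat -> nat -> R) :
  (forall i j, (j < m <= i)%N -> (i < N)%N -> F i j = 0) ->
  \det (\matrix_(i < N, j < N) F i j) =
    \det (\matrix_(i < m, j < m) F i j) *
    \det (\matrix_(i < n, j < n) F (m + i)%N (m + j)%N).
Proof.
have dtr k (G : nat -> nat -> R) :
    \det (\matrix_(i < k, j < k) G i j) = \det (\matrix_(i < k, j < k) G j i).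
  by rewrite -det_tr; congr (\det _); apply/matrixP=> i j; rewrite !mxE.
move=> F0; rewrite (dtr N) (dtr m) (dtr n (fun i j => F (m + i)%N (m + j)%N)).
by apply: (det_lblock_nat mnN (F := fun i j => F j i)) => i j; apply: F0.
Qed.

(** Both sides are the determinant of one product [P *m Q]. No division occurs, so repeated roots
    and zero divisors are allowed. *)
Lemma det_coef_eval d e N (deN : (d + e)%N = N) (p : nat -> {poly R})
    (g : {poly R}) (x : nat -> R) :
  (forall i, (i < N)%N -> (size (p i) <= N)%N) ->
  (forall i, (i < e)%N -> p (d + i)%N = 'X^i * g) ->
  (size g <= d.+1)%N -> (forall j, (j < d)%N -> root g (x j)) ->
  \det (\matrix_(i < N, j < N) (p i)`_j) *
    \det (\matrix_(i < d, j < d) x j ^+ i) =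
  \det (\matrix_(i < d, j < d) (p i).[x j]) * g`_d ^+ e.
Proof.
move=> size_p pE size_g gx0.
pose Q i j := if (j < d)%N then x j ^+ i else (i == j)%:R.
have detQ : \det (\matrix_(i < N, j < N) Q i j) =
            \det (\matrix_(i < d, j < d) x j ^+ i).
  rewrite (det_lblock_nat deN) => [|i j /andP[lt_id le_dj] _]; last first.
    by rewrite /Q ltnNge le_dj ltn_eqF // (leq_trans lt_id).
  rewrite [X in _ * \det X](_ : _ = 1%:M) ?det1 ?mulr1.
    by congr (\det _); apply/matrixP=> i j; rewrite !mxE /Q ltn_ord.
  apply/matrixP=> i j.
  by rewrite !mxE /Q ltnNge leq_addr eqn_add2l.
pose F i j := if (j < d)%N then (p i).[x j] else (p i)`_j.
have mulPQ : (\matrix_(i < N, j < N) (p i)`_j) *m (\matrix_(i < N, j < N) Q i j)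
             = \matrix_(i < N, j < N) F i j.
  apply/matrixP=> i j; rewrite !mxE /F; case: ifP => ltjd.
    rewrite (horner_coef_wide _ (size_p i (ltn_ord i))).
    by apply: eq_bigr => k _; rewrite !mxE /Q ltjd.
  (* Here column [j] of [Q] is a unit vector, so the coefficient is left unchanged. *)
  rewrite (bigD1 j) //= !mxE /Q ltjd eqxx mulr1 big1 ?addr0 // => k neq_kj.
  by rewrite !mxE ltjd (negPf neq_kj : (k == j :> nat) = false) mulr0.
rewrite -detQ -det_mulmx mulPQ (det_ublock_nat deN); last first.
  move=> i j /andP[ltjd ledi] ltiN; rewrite /F ltjd -(subnKC ledi) pE; last by lia.
  by rewrite hornerM (rootP (gx0 j ltjd)) mulr0.
congr (_ * _).
  by congr (\det _); apply/matrixP=> i j; rewrite !mxE /F ltn_ord.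
rewrite det_trig.
  rewrite -[e in RHS]card_ord -prodr_const; apply: eq_bigr => i _.
  rewrite mxE /F ltnNge leq_addr /= pE // coefXnM ifF; last by lia.
  by congr (g`_ _); lia.
apply/is_trig_mxP => i j lt_ij; rewrite mxE /F ltnNge leq_addr /= pE //.
rewrite coefXnM; case: ifP => // _; apply: nth_default.
by apply: leq_trans size_g _; lia.
Qed.

End NatIndexedDeterminants.

(** * The subresultant matrix bordered by unit rows *)

Lemma sorted_enum_ord n (A : {set 'I_n}) : sorted ltn (map val (enum A)).
Proof.
rewrite sorted_map /enum_mem; apply: sorted_filter.
  by move=> ? ? ?; apply: ltn_trans.
by rewrite -enumT -sorted_map val_enum_ord iota_ltn_sorted.
Qed.

Section BorderedSubresultant.
Variables (R : comNzRingType) (d1 d2 t : nat) (S : {set 'I_t.+1}).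
Hypotheses (d2_gt0 : (0 < d2)%N) (ltt : (t < d1 + d2)%N).
Hypothesis cardS : #|S| = kdim d1 d2 t.
Variables f g : {poly R}.

Let T := (tstar d2 t).+1.
Let m := (#|S| + (tstar d2 t - t))%N.
Let b (i : nat) : 'I_T := nth ord0 (reordered d2 S) i.

(** The deleted monomials come first and the multiples of [g] last, so that the first [d2] rows
    evaluate to the rows of [Omx]. *)
Definition border_row (i : nat) : {poly R} :=
  if (i < m)%N then 'X^(b i)
  else if (i < d2)%N then 'X^(i - m) * f else 'X^(i - d2) * g.

Let mE : (m + (t.+1 - d1))%N = d2.
Proof. by rewrite -addnA; apply: height_Omx. Qed.

Let TE : (d2 + (T - d2))%N = T.
Proof. by rewrite /T /tstar; lia. Qed.

Let T_sub_d2 : (T - d2)%N = (t.+1 - d2)%N.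
Proof. by rewrite /T /tstar; lia. Qed.

Lemma nth_reordered_low (i : 'I_#|S|) : b i = enum_val i :> nat.
Proof.
have lowE : map val (enum (lowS d2 S)) = map val (enum S).
  (* Strictly increasing lists with the same elements are equal. *)
  apply: (irr_sorted_eq ltn_trans ltnn (sorted_enum_ord _) (sorted_enum_ord _)).
  move=> k; apply/mapP/mapP => -[e]; rewrite mem_enum.
    by case/imsetP=> e' Se' -> ->; exists e'; rewrite ?mem_enum.
  move=> Se ->; exists (widen_ord (leq_tstar d2 t) e) => //.
  by rewrite mem_enum; apply: imset_f.
rewrite /b nth_cat -cardE card_lowS ltn_ord -(nth_map _ 0%N); last first.
  by rewrite -cardE card_lowS.
by rewrite lowE (nth_map (enum_val i)) -?cardE // -enum_val_nth.
Qed.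

Lemma nth_reordered_high i :
  (i < tstar d2 t - t)%N -> b (#|S| + i) = (t.+1 + i)%N :> nat.
Proof.
move=> lti.
have highE : map val (enum (highmon d2 t)) = iota t.+1 (tstar d2 t - t).
  apply: (irr_sorted_eq ltn_trans ltnn (sorted_enum_ord _) (iota_ltn_sorted _ _)).
  move=> k; rewrite mem_iota; apply/mapP/idP => [[e]|ltk].
    by rewrite mem_enum inE => lte ->; have := ltn_ord e; rewrite /=; lia.
  have ltkT : (k < T)%N by rewrite /T; lia.
  by exists (Ordinal ltkT) => //; rewrite mem_enum inE /=; case/andP: ltk.
rewrite /b nth_cat -cardE card_lowS ifF; last by lia.
rewrite addKn nth_cat -cardE card_highmon lti -(nth_map _ 0%N).
  by rewrite highE nth_iota.
by rewrite -cardE card_highmon.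
Qed.

Lemma nth_reordered_kept (i : 'I_#|kept d2 S|) : b (m + i) = enum_val i.
Proof.
rewrite /b nth_cat -cardE card_lowS ifF; last by rewrite /m; lia.
rewrite nth_cat -cardE card_highmon ifF; last by rewrite /m; lia.
by rewrite [RHS](enum_val_nth ord0) -subnDA addKn.
Qed.

Lemma det_border_coef :
  \det (\matrix_(i < T, j < T) (border_row i)`_j) =
    sg d2 S R * subresultant ltt cardS f g.
Proof.
set P := (\matrix_(i, j) _).
(* Moving the deleted columns to the front costs the sign, which is its own inverse. *)
have -> : \det P = sg d2 S R * \det (col_perm (reorder_perm d2 S) P).
  rewrite col_permE det_mulmx det_perm odd_permV mulrCA -expr2 -exprM.
  by rewrite mulnC exprM sqrrN expr1n expr1n mulr1.
congr (_ * _).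
have mT : (m + (t.+1 - d1 + (t.+1 - d2)))%N = T.
  by rewrite addnA mE -T_sub_d2 TE.
have -> : col_perm (reorder_perm d2 S) P =
          \matrix_(i < T, j < T) (border_row i)`_(b j).
  by apply/matrixP=> i j; rewrite !mxE permE.
have b_eq i j : (i < T)%N -> (j < T)%N -> (b i == b j :> nat) = (i == j).
  move=> lti ltj; apply/eqP/eqP=> [|->//] eqb.
  have := @reordered_inj d2 t S (Ordinal lti) (Ordinal ltj) (val_inj eqb).
  by move/(congr1 val).
(* After reordering, the unit rows read identity block, then zeros; the remaining diagonal block is
   the subresultant matrix. *)
rewrite (det_lblock_nat mT (F := fun i j => (border_row i)`_(b j))); last first.
  move=> i j /andP[lt_im le_mj] ltjT.
  by rewrite /border_row lt_im coefXn b_eq ?gtn_eqF //; lia.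
rewrite [X in \det X * _](_ : _ = 1%:M) ?det1 ?mul1r; last first.
  apply/matrixP=> i j; have := ltn_ord i; have := ltn_ord j => ltj lti.
  by rewrite !mxE /border_row lti coefXn b_eq 1?eq_sym //; lia.
congr (\det _); apply/matrixP=> i j.
rewrite castmxE !mxE /= cast_ord_id.
have -> : b (m + j) = enum_val (cast_ord (esym (card_kept ltt cardS)) j).
  by rewrite -nth_reordered_kept.
have := ltn_ord i.
case: splitP => i' ->; rewrite mxE /border_row => lti.
  rewrite ifF; last by lia.
  rewrite ifT; last by have := ltn_ord i'; lia.
  by rewrite addKn.
rewrite ifF; last by lia.
rewrite ifF; last by lia.
by have -> : (m + (t.+1 - d1 + i') - d2)%N = i' by lia.
Qed.

(** This equates the two evaluations of the bordered determinant, before any division by the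
    Vandermonde determinant. *)
Lemma subresultant_mul_Vandermonde (xi : 'I_d2 -> R) :
  (size f <= d1.+1)%N -> (size g <= d2.+1)%N -> (forall j, root g (xi j)) ->
  subresultant ltt cardS f g * \det (Vandermonde d2 (\row_(j < d2) xi j)) =
    sg d2 S R * g`_d2 ^+ (T - d2) * \det (Omx d2_gt0 ltt cardS f xi).
Proof.
move=> size_f size_g g_xi.
(* The default 0 only concerns indices from [d2] on, which are never read. *)
pose x j := oapp xi 0 (insub j).
have xE (j : 'I_d2) : x j = xi j by rewrite /x valK.
have sgK : sg d2 S R * sg d2 S R = 1.
  by rewrite /sg -expr2 -exprM mulnC exprM sqrrN !expr1n.
have := @det_coef_eval R d2 (T - d2) T TE border_row g x.
rewrite det_border_coef => /(_ _ _ size_g _) E.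
(* Inserting the square of the sign makes the bordered determinant appear on the left. *)
rewrite -[LHS]mul1r -sgK -!mulrA; congr (_ * _); rewrite mulrA.
rewrite [X in _ * \det X](_ : _ = \matrix_(i < d2, j < d2) x j ^+ i); last first.
  by apply/matrixP=> i j; rewrite !mxE xE.
rewrite E.
- rewrite mulrC; congr (_ * \det _); apply/matrixP=> i j.
  rewrite castmxE !mxE /= cast_ord_id.
  have := ltn_ord i.
  case: splitP => i' /= ->; rewrite mxE xE /border_row => lti.
    by rewrite (ltn_addr _ (ltn_ord i')) hornerXn nth_reordered_low.
  case: splitP lti => i'' /= ->; rewrite mxE => lti.
    by rewrite ltn_add2l ltn_ord hornerXn nth_reordered_high.
  move: lti; rewrite addnA -/m => lti.
  by rewrite ltnNge leq_addr /= lti hornerM hornerXn addKn.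
- move=> i ltiT; rewrite /border_row; case: ifP => [_|]; first by rewrite size_polyXn.
  move=> lemi; have lett : (t <= tstar d2 t)%N by rewrite leq_maxr.
  have sizeM k (h : {poly R}) : (size ('X^k * h)%R <= k + size h)%N.
    by apply: leq_trans (size_polyMleq _ _) _; rewrite size_polyXn.
  case: ifP => lei; apply: leq_trans (sizeM _ _) _.
    by have := mE; rewrite /T; lia.
  by have := T_sub_d2; have := TE; rewrite /T; lia.
- move=> i _; rewrite /border_row ifF; last by have := mE; lia.
  by rewrite ltnNge leq_addr /= addKn.
- by move=> j ltj; rewrite (xE (Ordinal ltj)).
Qed.

End BorderedSubresultant.

(** * Images under ring morphisms *)

Lemma map_subresultant (F R : comNzRingType) (h : {rmorphism F -> R})
    (d1 d2 t : nat) (S : {set 'I_t.+1}) (ltt : (t < d1 + d2)%N)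
    (cardS : #|S| = kdim d1 d2 t) (f g : {poly F}) :
  h (subresultant ltt cardS f g) =
  subresultant ltt cardS (map_poly h f) (map_poly h g).
Proof.
rewrite -det_map_mx map_castmx; congr (\det (castmx _ _)).
apply/matrixP=> i j; rewrite !mxE.
by case: splitP => i' _; rewrite !mxE -coef_map rmorphM /= map_polyXn.
Qed.

Lemma coef_sumZXn (R : nzRingType) n (c : 'I_n -> R) (j : 'I_n) :
  (\sum_(i < n) c i *: 'X^i)`_j = c j.
Proof.
rewrite coef_sum (bigD1 j) //= coefZ coefXn eqxx mulr1 big1 ?addr0 // => i.
rewrite coefZ coefXn eq_sym => /negPf nij.
by rewrite (nij : (j == i :> nat) = false) mulr0.
Qed.

Lemma size_sumZXn (R : nzRingType) n (c : 'I_n -> R) :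
  (size (\sum_(i < n) c i *: 'X^i)%R <= n)%N.
Proof.
apply: leq_trans (size_sum _ _ _) _; apply/bigmax_leqP => i _.
by apply: leq_trans (size_scale_leq _ _) _; rewrite size_polyXn.
Qed.

Lemma map_sumZXn (R R' : nzRingType) (h : {rmorphism R -> R'}) n
    (c : 'I_n -> R) :
  map_poly h (\sum_(i < n) c i *: 'X^i) = \sum_(i < n) h (c i) *: 'X^i.
Proof.
by rewrite rmorph_sum; apply: eq_bigr => i _; rewrite /= map_polyZ map_polyXn.
Qed.

(** * Separability through the resultant with the derivative *)

Lemma separable_resultant (R : idomainType) (p : {poly R}) :
  p != 0 -> separable_poly p = (resultant p p^`() != 0).
Proof.
move=> p_neq0; rewrite unlock /coprimep resultant_eq0 -leqNgt eqn_leq.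
by rewrite andbC lt0n size_poly_eq0 gcdp_eq0 (negPf p_neq0).
Qed.

(* [mxpoly.map_resultant] only covers morphisms from a ring of polynomials. *)
Lemma rmorph_resultant (R R' : nzRingType) (h : {rmorphism R -> R'})
    (p q : {poly R}) :
  h (lead_coef p) != 0 -> h (lead_coef q) != 0 ->
  h (resultant p q) = resultant (map_poly h p) (map_poly h q).
Proof.
move=> hp hq; rewrite -det_map_mx /resultant /Sylvester_mx !size_map_poly_id0 //.
congr (\det _); apply/matrixP=> i j; rewrite !mxE.
by case: (split i) => k; rewrite !mxE /= -coef_map rmorphM /= map_rVpoly map_delta_mx.
Qed.

(** The hypothesis keeps the leading coefficients of [p] and of its derivative nonzero under [h], so
    neither degree drops and the Sylvester matrix keeps its size. *)
Lemma map_resultant_deriv (R R' : nzRingType) (h : {rmorphism R -> R'})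
    (p : {poly R}) :
  h (lead_coef p) *+ (size p).-1 != 0 ->
  h (resultant p p^`()) = resultant (map_poly h p) (map_poly h p)^`().
Proof.
move=> lead_p; rewrite deriv_map.
have lead_p' : lead_coef p^`() = lead_coef p *+ (size p).-1.
  (* A nonzero multiple by [(size p).-1] forces [p] to be nonconstant. *)
  have size_p : (size p).-2.+1 = (size p).-1.
    by case: (size p) lead_p => [|[|n]]; rewrite ?mulr0n ?eqxx.
  have coefp' : p^`()`_(size p).-2 = lead_coef p *+ (size p).-1.
    by rewrite coef_deriv size_p.
  rewrite lead_coefE -coefp'; congr (_`_ _); apply/eqP; rewrite eqn_leq.
  apply/andP; split.
    have := size_poly (size p).-1 (fun i => p`_i.+1 *+ i.+1).
    by rewrite -/(deriv p); lia.
  rewrite -ltnS; apply: leq_trans (leqSpred _).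
  rewrite ltnNge; apply: contra lead_p => /(nth_default 0).
  by rewrite coefp' -rmorphMn /= => ->; rewrite rmorph0.
by apply: rmorph_resultant; last rewrite lead_p' rmorphMn //;
  apply: contra lead_p => /eqP->; rewrite mul0rn.
Qed.

Lemma separable_map_idomain (R R' : idomainType) (h : {rmorphism R -> R'})
    (p : {poly R}) :
  h (lead_coef p) *+ (size p).-1 != 0 ->
  separable_poly (map_poly h p) = (h (resultant p p^`()) != 0).
Proof.
move=> lead_p; rewrite map_resultant_deriv // separable_resultant //.
rewrite map_poly_eq0_id0; apply: contra lead_p.
  by rewrite -lead_coef_eq0 => /eqP->; rewrite rmorph0 mul0rn.
by move/eqP->; rewrite mul0rn.
Qed.

(** A resultant that is nonzero after [h] is nonzero in [R], hence also after the injective [k]. *)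
Lemma separable_specialization (R R1 R2 : idomainType)
    (h : {rmorphism R -> R1}) (k : {rmorphism R -> R2}) (p : {poly R}) :
  injective k -> h (lead_coef p) *+ (size p).-1 != 0 ->
  separable_poly (map_poly h p) -> separable_poly (map_poly k p).
Proof.
move=> k_inj hp; rewrite separable_map_idomain // => hres.
have k_neq0 a : h a != 0 -> k a != 0.
  by apply: contra; rewrite -(rmorph0 k) (inj_eq k_inj) => /eqP->; rewrite rmorph0.
by rewrite separable_map_idomain ?k_neq0 // -rmorphMn k_neq0 // rmorphMn.
Qed.

(** * Distinct roots of the generic [g], and the final division *)

Lemma separable_ggen d1 d2 : (0 < d2)%N -> separable_poly (ggen d1 d2).
Proof.
move=> d2_gt0; pose n := (d1.+1 + d2.+1)%N.
(* Specialization is defined on polynomials in the indeterminates, not on fractions, so [g] is first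
   lifted there. *)
pose gM : {poly {mpoly rat[n]}} := \sum_(j < d2.+1) 'X_(rshift d1.+1 j) *: 'X^j.
have ggenE : ggen d1 d2 = map_poly (@tofrac _) gM by rewrite map_sumZXn.
(* The value is 1 at the leading coefficient of [g], -1 at its constant term and 0 at all other
   indeterminates; the two indices differ as [d2] is positive. *)
pose v (i : 'I_n) : rat :=
  if split i is inr j then (j == d2 :> nat)%:R - (j == 0%N :> nat)%:R else 0.
have vE j : v (rshift d1.+1 j) = (j == d2 :> nat)%:R - (j == 0%N :> nat)%:R.
  by rewrite /v (unsplitK (inr j)).
have map_gM : map_poly (meval v) gM = 'X^d2 - 1.
  rewrite map_sumZXn; apply/polyP=> i; rewrite coefB coefXn coef1.
  have [lti|lei] := ltnP i d2.+1.
    by rewrite (coef_sumZXn _ (Ordinal lti)) /= mevalXU vE.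
  rewrite nth_default ?(leq_trans (size_sumZXn _)) //.
  by rewrite !gtn_eqF ?subrr //; lia.
have gM_d2 : gM`_d2 = 'X_(rshift d1.+1 ord_max) by exact: coef_sumZXn _ ord_max.
have X_neq0 : 'X_(rshift d1.+1 (@ord_max d2)) != 0 :> {mpoly rat[n]}.
  by apply/eqP => /(congr1 (meval v)); rewrite mevalXU vE meval0 eqxx gtn_eqF.
have size_gM : size gM = d2.+1.
  apply/eqP; rewrite eqn_leq size_sumZXn ltnNge.
  by apply: contra X_neq0 => /(nth_default 0) <-; rewrite gM_d2.
have lead_gM : lead_coef gM = 'X_(rshift d1.+1 ord_max).
  by rewrite lead_coefE size_gM.
have d2_neq0 : d2%:R != 0 :> rat.
  by rewrite Num.Theory.pnatr_eq0 -lt0n.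
have meval_lead : meval v (lead_coef gM) *+ (size gM).-1 != 0.
  by rewrite lead_gM size_gM mevalXU vE eqxx gtn_eqF // subr0.
rewrite ggenE; apply: separable_specialization meval_lead _.
  by move=> a c /eqP; rewrite tofrac_eq => /eqP.
by rewrite map_gM separable_Xn_sub_1.
Qed.

(** Counting: [p] has [d] distinct roots, and a family of length [d] that reaches all of them cannot
    repeat a value. *)
Lemma roots_enum_inj (L : closedFieldType) (p : {poly L}) d (xi : 'I_d -> L) :
  separable_poly p -> size p = d.+1 ->
  (forall z, root p z -> exists j, z = xi j) -> injective xi.
Proof.
move=> sep_p size_p xi_p; have p_neq0 := separable_poly_neq0 sep_p.
have [r def_p] := closed_field_poly_normal p.
have lead_neq0 : lead_coef p != 0 by rewrite lead_coef_eq0.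
have uniq_r : uniq r.
  rewrite -separable_prod_XsubC -(eqp_separable (eqp_scale _ lead_neq0)).
  by rewrite -def_p.
have size_r : size r = d.
  by move: size_p; rewrite def_p size_scale // size_prod_XsubC => -[].
apply/injectiveP; rewrite /injectiveb /dinjectiveb.
apply: (leq_size_uniq uniq_r) => [z rz|]; last first.
  by rewrite size_map size_enum_ord size_r.
have /xi_p[j ->] : root p z.
  by rewrite def_p rootZ // root_prod_XsubC.
by rewrite map_f // mem_enum.
Qed.

Lemma det_Vandermonde_neq0 (R : idomainType) n (xi : 'I_n -> R) :
  injective xi -> \det (Vandermonde n (\row_(j < n) xi j)) != 0.
Proof.
move=> xi_inj; rewrite det_Vandermonde; apply/prodf_neq0 => i _.
apply/prodf_neq0 => j lt_ij; rewrite !mxE subr_eq0.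
by apply: contraTneq lt_ij => /xi_inj ->; rewrite ltnn.
Qed.

Theorem theorem2p2 (d1 d2 : nat) (d1_gt0 : (0 < d1)%N) (d2_gt0 : (0 < d2)%N)
    (L : closedFieldType) (iota : {rmorphism coefField d1 d2 -> L})
    (iota_closure : algebraic_closure iota)
    (xi : 'I_d2 -> L)
    (xi_roots : forall z : L,
       root (map_poly iota (ggen d1 d2)) z <-> exists j : 'I_d2, z = xi j)
    (t : nat) (ltt : (t < d1 + d2)%N)
    (S : {set 'I_t.+1}) (cardS : #|S| = kdim d1 d2 t) :
  iota (subresultant ltt cardS (fgen d1 d2) (ggen d1 d2)) =
    sg d2 S L * iota (bcoef d1 (@ord_max d2)) ^+ ((tstar d2 t).+1 - d2)
    * (\det (Omx d2_gt0 ltt cardS (map_poly iota (fgen d1 d2)) xi)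
       / \det (Vandermonde d2 (\row_(j < d2) xi j))).
Proof.
have coef_g : (ggen d1 d2)`_d2 = bcoef d1 ord_max by exact: coef_sumZXn _ ord_max.
have size_g : size (ggen d1 d2) = d2.+1.
  apply/eqP; rewrite eqn_leq size_sumZXn ltnNge.
  apply/negP => /(nth_default 0); rewrite coef_g => /eqP.
  (* An indeterminate is nonzero because it takes the value 1 when all variables are set to 1. *)
  rewrite tofrac_eq0 => /eqP/(congr1 (meval (fun=> 1))).
  by rewrite mevalXU meval0 => /eqP; rewrite oner_eq0.
have xi_inj : injective xi.
  apply: (roots_enum_inj (p := map_poly iota (ggen d1 d2))).
  - by rewrite separable_map separable_ggen.
  - by rewrite size_map_poly.
  - by move=> z /xi_roots.
have V_neq0 := det_Vandermonde_neq0 xi_inj.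
(* Clearing the nonzero denominator leaves the division-free identity over [L], where the roots
   live. *)
rewrite mulrA; apply: (canRL (mulfK V_neq0)).
rewrite map_subresultant (subresultant_mul_Vandermonde d2_gt0).
- by rewrite coef_map coef_g.
- by rewrite size_map_poly size_sumZXn.
- by rewrite size_map_poly size_g.
- by move=> j; apply/xi_roots; exists j.
Qed.
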